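(* Let $m\ge 2$ and let $p_j\in\mathbb{R}^2$, $j=1,\ldots,m$, be pairwise distinct points. The line defined by the equation $\langle q,n\rangle=c$ with $n\in S^1$ and $c\in\mathbb{R}$ has minimal geometric $L^1$-distance to the set $\{p_1,\ldots,p_m\}$ if and only if $(c,n)\in\bar E$.
   Context: Let $f:\mathbb{R}\times S^1\to\mathbb{R}$, $f(c,n)=\sum_{j=1}^m|c-\langle p_j,n\rangle|$, where $\langle\cdot,\cdot\rangle$ is the Euclidean inner product and $S^1\subset\mathbb{R}^2$ the unit circle. The line $\{q\in\mathbb{R}^2:\langle q,n\rangle=c\}$ has minimal geometric $L^1$-distance to $\{p_1,\ldots,p_m\}$ if $f$ attains its global minimum over $\mathbb{R}\times S^1$ at $(c,n)$. Let $J=\begin{pmatrix}0&-1\\1&0\end{pmatrix}$. For $j>k$ set $n_{jk}=J(p_j-p_k)/\|p_j-p_k\|$ and $c_{jk}=\langle p_k,n_{jk}\rangle$, so that $\langle q,n_{jk}\rangle=c_{jk}$ is the line through $p_j$ and $p_k$. Define $$E=\{\pm(c_{jk},n_{jk}) : j>k,\ f(c_{jk},n_{jk})=\min\{f(c,n):c\in\mathbb{R},n\in S^1\}\}$$ (both signs are included, where $-(c,n)=(-c,-n)$), and $$\bar E=\{(c,n)\in\mathbb{R}\times S^1 : \exists\, t\in[0,1],\ (c_0,n),(c_1,n)\in E \text{ with } c=tc_0+(1-t)c_1\}.$$ *)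

(* Defs.v *)
From HB Require Import structures.
From mathcomp Require Import all_boot all_order all_algebra.
From mathcomp Require Import all_classical all_reals.

Set Implicit Arguments.
Unset Strict Implicit.
Unset Printing Implicit Defensive.

Import Order.TTheory GRing.Theory Num.Theory.
Local Open Scope classical_set_scope.
Local Open Scope ring_scope.

Section Lines.
Variable R : realType.

Definition dot (u v : 'cV[R]_2) : R := \sum_(i < 2) u i 0 * v i 0.

(* The library norm `|v| on matrices is the sup norm, so the Euclidean norm is
   defined here. *)
Definition enorm (v : 'cV[R]_2) : R := Num.sqrt (dot v v).

Definition S1 : set 'cV[R]_2 := [set n | enorm n = 1].

Definition J : 'M[R]_2 :=
  \matrix_(i < 2, j < 2) nth 0 (nth [::] [:: [:: 0; -1]; [:: 1; 0]] i) j.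

Definition is_min (A : set R) (a : R) : Prop := A a /\ lbound A a.

Variables (m : nat) (p : 'I_m -> 'cV[R]_2).

Definition L1dist (x : R * 'cV[R]_2) : R :=
  \sum_(j < m) `|x.1 - dot (p j) x.2|.

Definition L1dist_values : set R := [set L1dist x | x in [set: R] `*` S1].

(* The line [set q | dot q n = c] is encoded by the pair (c, n), n in S1; the
   pairs (c, n) and (- c, - n) encode the same line. *)
Definition minimal_line (c : R) (n : 'cV[R]_2) : Prop :=
  S1 n /\ is_min L1dist_values (L1dist (c, n)).

Definition normal (j k : 'I_m) : 'cV[R]_2 :=
  (enorm (p j - p k))^-1 *: (J *m (p j - p k)).

Definition offset (j k : 'I_m) : R := dot (p k) (normal j k).

Definition E : set (R * 'cV[R]_2) :=
  [set x | exists j k : 'I_m,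
    [/\ (k < j)%N,
        is_min L1dist_values (L1dist (offset j k, normal j k))
      & x = (offset j k, normal j k) \/ x = (- offset j k, - normal j k)]].

Definition Ebar : set (R * 'cV[R]_2) :=
  [set x | S1 x.2 /\ exists t c0 c1 : R,
    [/\ 0 <= t <= 1, E (c0, x.2), E (c1, x.2)
      & x.1 = t * c0 + (1 - t) * c1]].

End Lines.

(* Main.v *)
Require Import Defs.
From mathcomp Require Import all_boot all_order all_algebra.
From mathcomp Require Import all_classical all_reals.
From mathcomp Require Import ring lra.

Set Implicit Arguments.
Unset Strict Implicit.
Unset Printing Implicit Defensive.

Import Order.TTheory GRing.Theory Num.Theory.
Local Open Scope ring_scope.

(** Two facts about a minimal line [(c, n)] give the theorem.

    With the normal [n] fixed, [L1dist] is convex in the offset and affine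
    between consecutive projections [<p_j, n>]. A minimum at an interior point
    of such a gap therefore extends to both ends of the gap, and a minimal [c]
    cannot lie outside the range of the projections, since moving the line
    towards the points would then bring it closer to all of them. So [c] is a
    convex combination of two projections of points, each of which is itself the
    offset of a minimal line with normal [n] ([minimal_line_between]).

    With a point [p_j] on the line fixed, [L1dist] is, as a function of the
    angle, a sum of terms [r_k * |sin (theta - theta_k)|], each strictly concave
    away from its zero. At a minimum some term with [k != j] must vanish, that
    is, the line passes through a second point
    ([minimal_line_second_point]). In the plane the unit normal of a line
    through two distinct points is determined up to sign, so such a line belongs
    to [E] ([line_through_two_in_E]).

    Conversely, convexity in the offset shows that the lines between two
    parallel minimal lines are minimal ([L1dist_convex]). *)

(** * Plane geometry *)

Section Plane.
Variable R : realType.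
Implicit Types u v w d n : 'cV[R]_2.

Lemma dotE u v : dot u v = u 0 0 * v 0 0 + u 1 0 * v 1 0.
Proof.
rewrite /dot big_ord_recr big_ord1 /=.
by congr (u _ _ * v _ _ + u _ _ * v _ _); apply: val_inj.
Qed.

Lemma dotC u v : dot u v = dot v u.
Proof. by apply: eq_bigr => i _; rewrite mulrC. Qed.

Lemma dotDr u v w : dot w (u + v) = dot w u + dot w v.
Proof. by rewrite !dotE !mxE; ring. Qed.

Lemma dotDl u v w : dot (u + v) w = dot u w + dot v w.
Proof. by rewrite !(dotC _ w) dotDr. Qed.

Lemma dotBl u v w : dot (u - v) w = dot u w - dot v w.
Proof. by rewrite !dotE !mxE; ring. Qed.

Lemma dotZr a u w : dot w (a *: u) = a * dot w u.
Proof. by rewrite !dotE !mxE; ring. Qed.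

Lemma dotNr u w : dot w (- u) = - dot w u.
Proof. by rewrite -scaleN1r dotZr mulN1r. Qed.

Lemma dotvv_ge0 v : 0 <= dot v v.
Proof. by rewrite dotE -!expr2 addr_ge0 ?sqr_ge0. Qed.

Lemma cV2P u v : u 0 0 = v 0 0 -> u 1 0 = v 1 0 -> u = v.
Proof.
move=> e0 e1; apply/colP=> -[[|[|i]] hi] //.
- by rewrite (_ : Ordinal hi = 0) //; apply: val_inj.
- by rewrite (_ : Ordinal hi = 1) //; apply: val_inj.
Qed.

Lemma dotvv_gt0 v : v != 0 -> 0 < dot v v.
Proof.
move=> v0; rewrite lt0r dotvv_ge0 andbT; apply: contra v0.
rewrite dotE -!expr2 paddr_eq0 ?sqr_ge0 // !sqrf_eq0 => /andP[/eqP e0 /eqP e1].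
by apply/eqP/cV2P; rewrite mxE.
Qed.

Lemma JE v : ((J R *m v) 0 0 = - v 1 0) * ((J R *m v) 1 0 = v 0 0).
Proof.
split; rewrite !mxE big_ord_recr big_ord1 !mxE /=.
- by rewrite mul0r add0r mulN1r; congr (- v _ _); apply: val_inj.
- by rewrite mul1r mul0r addr0; congr (v _ _); apply: val_inj.
Qed.

Lemma S1P n : S1 n <-> dot n n = 1.
Proof.
rewrite /S1 /= /enorm; split=> [h|->]; last exact: sqrtr1.
by rewrite -(sqr_sqrtr (dotvv_ge0 n)) h expr1n.
Qed.

Lemma S1N n : S1 n -> S1 (- n).
Proof. by move=> /S1P h; apply/S1P; rewrite -h !dotE !mxE; ring. Qed.

Lemma dotZl a u w : dot (a *: u) w = a * dot u w.
Proof. by rewrite !dotE !mxE; ring. Qed.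

Lemma dotJJ v : dot (J R *m v) (J R *m v) = dot v v.
Proof. by rewrite !dotE !JE; ring. Qed.

Lemma dotJr v : dot v (J R *m v) = 0.
Proof. by rewrite !dotE !JE; ring. Qed.

Lemma enorm_sqr v : enorm v ^+ 2 = dot v v.
Proof. by rewrite sqr_sqrtr // dotvv_ge0. Qed.

Lemma enorm_gt0 v : v != 0 -> 0 < enorm v.
Proof. by move=> /dotvv_gt0 v0; rewrite sqrtr_gt0. Qed.

Lemma S1_normalize v : v != 0 -> S1 ((enorm v)^-1 *: v).
Proof.
move=> /enorm_gt0 r0; apply/S1P.
by rewrite dotZl dotZr -enorm_sqr; field; rewrite gt_eqF.
Qed.

(** The plane has a single direction orthogonal to [d], spanned by [J d]; the
    coefficient of [n] on it is [<n, J d> / |d|], whose square is 1 by Lagrange's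
    identity. *)
Lemma unit_orthogonal d n : d != 0 -> S1 n -> dot d n = 0 ->
  n = (enorm d)^-1 *: (J R *m d) \/ n = - ((enorm d)^-1 *: (J R *m d)).
Proof.
move=> /enorm_gt0 /lt0r_neq0 r0 /S1P n1 dn.
have r2 := enorm_sqr d.
pose s := (d 0 0 * n 1 0 - d 1 0 * n 0 0) / enorm d.
(* Each coordinate identity, and then s ^+ 2 = 1, is multiplied by |d|^2 and
   holds modulo <d, n> = 0 and <n, n> = 1. *)
have sn : n = s *: ((enorm d)^-1 *: (J R *m d)).
  rewrite !dotE in r2 dn; apply: cV2P; rewrite mxE [in RHS]mxE JE /s.
    apply: (mulIf (expf_neq0 2 r0)).
    transitivity (- d 1 0 * (d 0 0 * n 1 0 - d 1 0 * n 0 0)); last by field.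
    rewrite r2; apply: subr0_eq.
    transitivity (d 0 0 * (d 0 0 * n 0 0 + d 1 0 * n 1 0)); first by ring.
    by rewrite dn mulr0.
  apply: (mulIf (expf_neq0 2 r0)).
  transitivity (d 0 0 * (d 0 0 * n 1 0 - d 1 0 * n 0 0)); last by field.
  rewrite r2; apply: subr0_eq.
  transitivity (d 1 0 * (d 0 0 * n 0 0 + d 1 0 * n 1 0)); first by ring.
  by rewrite dn mulr0.
have /eqP : s ^+ 2 = 1.
  rewrite /s expr_div_n; apply: (mulIf (expf_neq0 2 r0)).
  rewrite divfK ?expf_neq0 // mul1r r2; rewrite !dotE in n1 dn *.
  transitivity ((d 0 0 * d 0 0 + d 1 0 * d 1 0) *
      (n 0 0 * n 0 0 + n 1 0 * n 1 0) -
      (d 0 0 * n 0 0 + d 1 0 * n 1 0) ^+ 2); first by ring.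
  by rewrite n1 dn; ring.
rewrite sqrf_eq1 => /orP[] /eqP s1; [left|right].
  by rewrite {1}sn s1 scale1r.
by rewrite {1}sn s1 scaleN1r.
Qed.

End Plane.

(** * Absolute values *)

(** Ensures that a small perturbation [x k +- e * y k] does not change the sign
    of any [x k]. *)
Lemma exists_small_slope (R : realType) (I : finType) (x y : I -> R) :
  (forall k, x k = 0 -> y k = 0) ->
  exists2 e, 0 < e & forall k, e * `|y k| <= `|x k|.
Proof.
move=> xy.
have y1 k : 0 < 1 + `|y k| by rewrite ltr_pwDl.
exists (\big[Order.min/1]_(k | x k != 0) (`|x k| / (1 + `|y k|))).
  apply: lt_bigmin => // k xk.
  by rewrite divr_gt0 ?normr_gt0.
move=> k; have [xk|xk] := eqVneq (x k) 0.
  by rewrite xy // xk normr0 mulr0.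
apply: (@le_trans _ _ (`|x k| / (1 + `|y k|) * `|y k|)).
  by rewrite ler_wpM2r // bigmin_le_cond.
by rewrite mulrAC ler_pdivrMr // ler_wpM2l // lerDr.
Qed.

Lemma normD_normB (R : realDomainType) (x y : R) :
  `|y| <= `|x| -> `|x + y| + `|x - y| = 2 * `|x|.
Proof.
case: (ger0P x); case: (ger0P y); case: (ger0P (x + y));
  by case: (ger0P (x - y)); lra.
Qed.

(** * Minimal lines *)

Section Lines.
Variables (R : realType) (m : nat) (p : 'I_m -> 'cV[R]_2).
Hypothesis m_gt1 : (2 <= m)%N.
Hypothesis p_inj : injective p.
Implicit Types (c : R) (n v : 'cV[R]_2).

Lemma minimal_lineP c n : S1 n -> minimal_line p c n <->
  forall c' n', S1 n' -> L1dist p (c, n) <= L1dist p (c', n').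
Proof.
move=> n1; split=> [[_ [_ lb]] c' n' n'1|lb].
  by apply: lb; exists (c', n').
split=> //; split; first by exists (c, n).
by move=> _ [[c' n'] [_ n'1] <-]; apply: lb.
Qed.

Lemma minimal_line_lb c n c' n' : minimal_line p c n -> S1 n' ->
  L1dist p (c, n) <= L1dist p (c', n').
Proof. by move=> mn n'1; apply: (iffLR (minimal_lineP c mn.1)). Qed.

Lemma L1distN c n : L1dist p (- c, - n) = L1dist p (c, n).
Proof.
by apply: eq_bigr => k _; rewrite /= dotNr -opprD normrN.
Qed.

Lemma minimal_lineN c n : minimal_line p c n -> minimal_line p (- c) (- n).
Proof. by move=> [n1 mn]; split; [exact: S1N|rewrite L1distN]. Qed.

Lemma minimal_line_le c n c' : minimal_line p c n ->
  L1dist p (c', n) <= L1dist p (c, n) -> minimal_line p c' n.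
Proof.
move=> mn le; have n1 := mn.1; apply/minimal_lineP => // c2 n2 n21.
by apply: le_trans le _; apply: minimal_line_lb.
Qed.

Lemma L1dist_convex t c0 c1 n : 0 <= t <= 1 ->
  L1dist p (t * c0 + (1 - t) * c1, n) <=
  t * L1dist p (c0, n) + (1 - t) * L1dist p (c1, n).
Proof.
move=> /andP[t0 t1].
rewrite /L1dist !mulr_sumr -big_split; apply: ler_sum => k _ /=.
set x := dot (p k) n.
have -> : t * c0 + (1 - t) * c1 - x = t * (c0 - x) + (1 - t) * (c1 - x).
  by ring.
apply: le_trans (ler_normD _ _) _.
by rewrite !normrM (ger0_norm t0) (@ger0_norm _ (1 - t)) ?subr_ge0.
Qed.

(** If all the points lay strictly above the line, translating it to the lowest
    of them would decrease every distance. *)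
Lemma minimal_line_has_below c n : minimal_line p c n ->
  exists j, dot (p j) n <= c.
Proof.
move=> mn; have n1 := mn.1; apply: contrapT => above.
have {}above j : c < dot (p j) n.
  by rewrite ltNge; apply/negP => le; apply: above; exists j.
pose j0 := Ordinal (ltnW m_gt1).
have [j _ jmin] := arg_minP (fun j => dot (p j) n) (isT : xpredT j0).
suff : L1dist p (dot (p j) n, n) < L1dist p (c, n).
  by rewrite ltNge minimal_line_lb.
apply: ltr_sum => [|k _ /=].
  by apply/hasP; exists j0; rewrite ?mem_index_enum.
have := above j; have := jmin k isT; have := above k => /= ? ? ?.
by rewrite !ler0_norm; lra.
Qed.

Lemma nearest_below c n : minimal_line p c n ->
  exists2 j, dot (p j) n <= c &
    forall k, dot (p k) n <= dot (p j) n \/ c < dot (p k) n.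
Proof.
move=> /minimal_line_has_below[j0 j0c].
have [j jc jmax] := arg_maxP (fun j => dot (p j) n)
  (j0c : [pred j | dot (p j) n <= c] j0).
exists j => // k; have [kc|kc] := leP (dot (p k) n) c; last by right.
by left; exact: jmax.
Qed.

(** The pairs [(c, n)] and [(- c, - n)] encode the same line, so this is
    [nearest_below] for the opposite normal. *)
Lemma nearest_above c n : minimal_line p c n ->
  exists2 j, c <= dot (p j) n &
    forall k, dot (p j) n <= dot (p k) n \/ dot (p k) n < c.
Proof.
move=> /minimal_lineN /nearest_below[j]; rewrite dotNr lerN2 => jc jmin.
by exists j => // k; move: (jmin k); rewrite dotNr lerN2 ltrN2.
Qed.

(** Let [a < c < a'] be the projections nearest to [c]. As no projection lies in
    between, [L1dist] is affine on [[a, a']]; an affine function that is minimal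
    at an interior point is constant, so both ends are minimal. When [c] is itself
    a projection, both ends are taken equal to it. *)
Lemma minimal_line_between c n : minimal_line p c n ->
  exists t j k, [/\ 0 <= t <= 1, minimal_line p (dot (p j) n) n,
    minimal_line p (dot (p k) n) n &
    c = t * dot (p j) n + (1 - t) * dot (p k) n].
Proof.
move=> mn; have n1 := mn.1.
have [j jc jmax] := nearest_below mn; have [k kc kmin] := nearest_above mn.
have [ac|ac] := eqVneq (dot (p j) n) c.
  by exists 0, j, j; rewrite ac; split=> //; [rewrite lexx ler01|ring].
have [a'c|a'c] := eqVneq (dot (p k) n) c.
  by exists 0, k, k; rewrite a'c; split=> //; [rewrite lexx ler01|ring].
set a := dot (p j) n in jc jmax ac *; set a' := dot (p k) n in kc kmin a'c *.
have {ac jc}ac : a < c by rewrite lt_neqAle ac.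
have {a'c kc}a'c : c < a' by rewrite lt_neqAle eq_sym a'c.
have affine : (a' - a) * L1dist p (c, n) =
    (a' - c) * L1dist p (a, n) + (c - a) * L1dist p (a', n).
  rewrite /L1dist !mulr_sumr -big_split /=; apply: eq_bigr => i _.
  have [ia|ci] := jmax i.
    rewrite !ger0_norm; [ring|lra..].
  have {ci}a'i : a' <= dot (p i) n by case: (kmin i) => //; lra.
  rewrite !ler0_norm; [ring|lra..].
have fa : L1dist p (c, n) <= L1dist p (a, n) by exact: minimal_line_lb.
have fa' : L1dist p (c, n) <= L1dist p (a', n) by exact: minimal_line_lb.
exists ((a' - c) / (a' - a)), j, k; split.
- by apply/andP; split; [rewrite divr_ge0|rewrite ler_pdivrMr]; lra.
- by apply: minimal_line_le mn _; nra.
- by apply: minimal_line_le mn _; nra.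
- by rewrite -/a -/a'; field; rewrite subr_eq0 gt_eqF //; lra.
Qed.

(** Minimality compared with the lines through [p j], made homogeneous in the
    normal so that rotated normals need not be normalized. *)
Lemma minimal_pencil_bound c n j v : minimal_line p c n -> v != 0 ->
  enorm v * L1dist p (c, n) <= \sum_k `|dot (p j - p k) v|.
Proof.
move=> mn v0; have r0 := enorm_gt0 v0; pose w := (enorm v)^-1 *: v.
have -> : \sum_k `|dot (p j - p k) v| = enorm v * L1dist p (dot (p j) w, w).
  rewrite /L1dist mulr_sumr; apply: eq_bigr => k _ /=.
  rewrite -dotBl dotZr normrM gtr0_norm ?invr_gt0 //.
  by rewrite mulrA mulfV ?mul1r // gt_eqF.
rewrite ler_wpM2l //; first exact: ltW.
by apply: minimal_line_lb => //; exact: S1_normalize.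
Qed.

Lemma L1dist_ge0 x : 0 <= L1dist p x.
Proof. exact: sumr_ge0. Qed.

(** Suppose that [p j] is the only point on the line, and rotate the line about
    it, using the normals [n +- e J n] of norm [sqrt (1 + e^2)]. For [e] small, no
    [<p_j - p_k, n>] changes sign, so the two perturbed sums average to exactly
    the minimum [f0]. By the homogeneous bound each of them is at least
    [sqrt (1 + e^2) * f0], which is impossible as [f0 > 0]: there is another
    point, and it is off the line. *)
Lemma minimal_line_second_point n j : minimal_line p (dot (p j) n) n ->
  exists2 k, k != j & dot (p k) n = dot (p j) n.
Proof.
move=> mn; have /S1P n1 := mn.1; apply: contrapT => alone.
have apart k : dot (p j - p k) n = 0 -> k = j.
  rewrite dotBl => /subr0_eq jk; apply: contrapT => kj.
  by apply: alone; exists k; [exact/eqP|].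
pose f0 := L1dist p (dot (p j) n, n).
have f0E : f0 = \sum_k `|dot (p j - p k) n|.
  by apply: eq_bigr => k _; rewrite dotBl.
have f0_gt0 : 0 < f0.
  rewrite lt0r L1dist_ge0 andbT f0E psumr_eq0 //; apply/negP => /allP all0.
  have eqj k : k = j.
    apply: apart; apply/eqP; rewrite -normr_eq0.
    by apply: all0; rewrite mem_index_enum.
  have /(congr1 val) // : Ordinal m_gt1 = Ordinal (ltnW m_gt1).
  by rewrite [LHS]eqj [RHS]eqj.
have [|e e0 small] := @exists_small_slope R _
    (fun k => dot (p j - p k) n) (fun k => dot (p j - p k) (J R *m n)).
  by move=> k /apart ->; rewrite subrr dotE !mxE !mul0r addr0.
pose v (s : R) := n + (s * e) *: (J R *m n).
have vv (s : R) : s ^+ 2 = 1 -> dot (v s) (v s) = 1 + e ^+ 2.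
  move=> s1; transitivity (dot n n * (1 + s ^+ 2 * e ^+ 2)).
    rewrite /v dotDr !dotDl !dotZr !dotZl (dotC _ n) dotJr dotJJ; ring.
  by rewrite n1 s1 !mul1r.
have bound (s : R) : s ^+ 2 = 1 ->
    Num.sqrt (1 + e ^+ 2) * f0 <= \sum_k `|dot (p j - p k) (v s)|.
  move=> s1; rewrite -(vv s s1); apply: minimal_pencil_bound => //.
  apply/eqP => v0; have := vv s s1; rewrite v0 dotE !mxE !mul0r addr0.
  by have := sqr_ge0 e; lra.
have sum2 : \sum_k `|dot (p j - p k) (v 1)| +
    \sum_k `|dot (p j - p k) (v (- 1))| = 2 * f0.
  rewrite -big_split f0E mulr_sumr; apply: eq_bigr => k _ /=.
  rewrite !dotDr !dotZr mul1r mulN1r mulNr; apply: normD_normB.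
  by rewrite normrM gtr0_norm.
have := bound 1 (expr1n _ _); have := bound (-1) (sqrr_sign R 1).
have : 1 < Num.sqrt (1 + e ^+ 2).
  by rewrite -[ltLHS]sqrtr1 ltr_sqrt ?ltrDl ?exprn_gt0 // ltr_pwDl // sqr_ge0.
by nra.
Qed.

Lemma line_through_two_in_E c n j k : k != j -> minimal_line p c n ->
  c = dot (p j) n -> c = dot (p k) n -> E p (c, n).
Proof.
wlog kj : j k / (k < j)%N.
  move=> wl kj mn cj ck; have : (k < j)%N || (j < k)%N by rewrite -neq_ltn.
  by move=> /orP[kj'|jk]; [apply: (wl j k)|apply: (wl k j) => //; rewrite eq_sym].
move=> neq [n1 mn] cj ck; exists j, k.
have d0 : p j - p k != 0.
  by rewrite subr_eq0; apply: contra neq => /eqP /p_inj ->.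
have dn : dot (p j - p k) n = 0 by rewrite dotBl -cj -ck subrr.
have [nE|nE] := unit_orthogonal d0 n1 dn; rewrite -/(normal p j k) in nE.
  have xE : (c, n) = (offset p j k, normal p j k) by rewrite /offset -nE -ck.
  by split=> //; [rewrite -xE|left].
have xE : (c, n) = (- offset p j k, - normal p j k).
  by rewrite /offset -dotNr -nE -ck.
by split=> //; [rewrite -L1distN -xE|right].
Qed.

Lemma E_minimal c n : S1 n -> E p (c, n) -> minimal_line p c n.
Proof.
by move=> n1 [j [k [_ mn [xE|xE]]]]; split=> //; rewrite xE ?L1distN.
Qed.

End Lines.

Theorem theorem5 (R : realType) (m : nat) (p : 'I_m -> 'cV[R]_2)
  (hm : (2 <= m)%N) (hp : injective p) (c : R) (n : 'cV[R]_2) (hn : S1 n) :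
  minimal_line p c n <-> Ebar p (c, n).
Proof.
have minE j : minimal_line p (dot (p j) n) n -> E p (dot (p j) n, n).
  move=> mn; have [k kj kE] := minimal_line_second_point hm mn.
  by apply: (line_through_two_in_E hp kj mn).
split=> [/(minimal_line_between hm)[t [j [k [t01 mj mk cE]]]]|].
  by split=> //; exists t, (dot (p j) n), (dot (p k) n); split=> //; apply: minE.
move=> [_ [t [c0 [c1 [/andP[t0 t1] /(E_minimal hn) m0 /(E_minimal hn) m1 /= ->]]]]].
have f10 : L1dist p (c1, n) <= L1dist p (c0, n) by exact: minimal_line_lb.
apply: minimal_line_le m0 _.
by apply: le_trans (L1dist_convex _ _ _ _ _) _; rewrite ?t0 //; nra.
Qed.
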